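(* There is an absolute constant $c>0$ such that the following holds. Let $L>0$ and let $A\in\mathbb{R}^{n\times n}$ be symmetric and nonzero with every nonzero eigenvalue of magnitude at least $L$. Let $S\in\mathbb{R}^{k\times n}$ satisfy Assumption L for $A$ with parameter $L$. Then for every $i$ with $\lambda_i(A)>0$, $SAS^T$ has at least $i$ eigenvalues and $|\lambda_i(SAS^T)-\lambda_i(A)|\le cL\log\frac{2\|A\|}{L}$; and for every $i$ with $\mu_i(A)<0$, $SAS^T$ has at least $i$ eigenvalues and $|\mu_i(SAS^T)-\mu_i(A)|\le cL\log\frac{2\|A\|}{L}$.
   Context: $\lambda_i(M)$ denotes the $i$-th largest and $\mu_i(M)$ the $i$-th smallest eigenvalue of a symmetric matrix $M$; $\|A\|$ is the operator norm. $S$ is an $\alpha$-distortion subspace embedding for $X$ (or its column span) if $(1-\alpha)\|Xv\|^2\le\|SXv\|^2\le(1+\alpha)\|Xv\|^2$ for all $v$. Assumption L (for symmetric $A$ and $L>0$): for every $\lambda\ge L$, $S$ is a $\min(L/\lambda,1/10)$-distortion subspace embedding for the span of all eigenvectors of $A$ whose eigenvalue has magnitude at least $\lambda$. *)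

(* Defs.v *)
From HB Require Import structures.
From mathcomp Require Import all_boot all_order all_algebra.
From mathcomp Require Import all_classical all_reals.
From mathcomp Require Import exp Rstruct.
Set Implicit Arguments. Unset Strict Implicit. Unset Printing Implicit Defensive.
Import Order.TTheory GRing.Theory Num.Theory.
Local Open Scope ring_scope.
Local Open Scope classical_set_scope.

Notation R := Rdefinitions.R.

(* Eigenvalues with (algebraic) multiplicity: a list s with
   char_poly M = prod_(x <- s) (X - x).  For real symmetric M such a list
   exists and is unique up to permutation. *)
Definition eig_list n (M : 'M[R]_n) : seq R :=
  match pselect (exists s : seq R, char_poly M = \prod_(x <- s) ('X - x%:P)) with
  | left H => projT1 (cid H)
  | right _ => [::]
  end.

Definition lambda_ n (M : 'M[R]_n) (i : nat) : R :=
  nth 0 (sort (fun x y : R => y <= x) (eig_list M)) i.-1.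

Definition mu_ n (M : 'M[R]_n) (i : nat) : R :=
  nth 0 (sort (fun x y : R => x <= y) (eig_list M)) i.-1.

Definition vnorm n (v : 'cV[R]_n) : R := Num.sqrt (\sum_i v i 0 ^+ 2).

Definition opnorm m n (M : 'M[R]_(m, n)) : R :=
  sup [set vnorm (M *m v) | v in [set v : 'cV[R]_n | vnorm v <= 1]].

Definition subspace_embedding k n (S : 'M[R]_(k, n)) (alpha : R)
    (V : set 'cV[R]_n) : Prop :=
  forall x, V x ->
    (1 - alpha) * vnorm x ^+ 2 <= vnorm (S *m x) ^+ 2 /\
    vnorm (S *m x) ^+ 2 <= (1 + alpha) * vnorm x ^+ 2.

Definition big_eigspan n (A : 'M[R]_n) (lam : R) : set 'cV[R]_n :=
  [set x | exists vs : seq 'cV[R]_n,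
     (forall v, v \in vs -> exists a : R, lam <= `|a| /\ A *m v = a *: v) /\
     x = \sum_(v <- vs) v].

Definition assumptionL k n (S : 'M[R]_(k, n)) (A : 'M[R]_n) (L : R) : Prop :=
  forall lam : R, L <= lam ->
    subspace_embedding S (Num.min (L / lam) (1 / 10)) (big_eigspan A lam).

(* Main.v *)
Require Import Defs.
From HB Require Import structures.
From mathcomp Require Import all_boot all_order all_algebra.
From mathcomp Require Import all_classical all_reals.
From mathcomp Require Import exp Rstruct.
From mathcomp Require Import complex spectral ring lra.
Import Order.TTheory GRing.Theory Num.Theory.
Local Open Scope ring_scope.
Set Implicit Arguments.
Unset Strict Implicit.
Unset Printing Implicit Defensive.

(* Cut the spectrum of A dyadically: E_r is the spectral projection of A onto
   |eigenvalue| in [th_(r+1), th_r) with th_r = 2^(m-r) L, for r < m, where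
   m = O(log (2 ||A|| / L)).  Going from the large eigenvalues down, a block
   Gram-Schmidt process (project S E_r off the range already built, then take
   the polar part) yields a partial isometry Q, isometric on the range of A,
   with ||(S - Q) E_r|| <= 4 L / th_(r+1): the distortion at a level is
   inversely proportional to the size of the eigenvalues there.  So each level
   contributes O(L) to S A S^T - Q A Q^T, whose norm is at most 20 L m.  As Q A Q^T has
   the nonzero spectrum of A, a dimension count as in Weyl's inequality
   concludes; the claim on mu is that on lambda for - A. *)

(** * Euclidean inner product and norm over a real closed field *)

Definition dot {F : rcfType} {n} (u v : 'cV[F]_n) : F := (u^T *m v) 0 0.

Definition nrm {F : rcfType} {n} (u : 'cV[F]_n) : F := Num.sqrt (dot u u).

Lemma dotE {F : rcfType} n (u v : 'cV[F]_n) : dot u v = \sum_i u i 0 * v i 0.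
Proof. by rewrite /dot mxE; apply: eq_bigr => i _; rewrite mxE. Qed.

Lemma dotC {F : rcfType} n (u v : 'cV[F]_n) : dot u v = dot v u.
Proof. by rewrite !dotE; apply: eq_bigr => i _; rewrite mulrC. Qed.

Lemma dotDr {F : rcfType} n (u v w : 'cV[F]_n) : dot u (v + w) = dot u v + dot u w.
Proof. by rewrite /dot mulmxDr mxE. Qed.

Lemma dotDl {F : rcfType} n (u v w : 'cV[F]_n) : dot (v + w) u = dot v u + dot w u.
Proof. by rewrite dotC dotDr !(dotC u). Qed.

Lemma dotZr {F : rcfType} n a (u v : 'cV[F]_n) : dot u (a *: v) = a * dot u v.
Proof. by rewrite /dot -scalemxAr mxE. Qed.

Lemma dotZl {F : rcfType} n a (u v : 'cV[F]_n) : dot (a *: u) v = a * dot u v.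
Proof. by rewrite dotC dotZr dotC. Qed.

Lemma dotNr {F : rcfType} n (u v : 'cV[F]_n) : dot u (- v) = - dot u v.
Proof. by rewrite -scaleN1r dotZr mulN1r. Qed.

Lemma dotNl {F : rcfType} n (u v : 'cV[F]_n) : dot (- u) v = - dot u v.
Proof. by rewrite dotC dotNr dotC. Qed.

Lemma dotBr {F : rcfType} n (u v w : 'cV[F]_n) : dot u (v - w) = dot u v - dot u w.
Proof. by rewrite dotDr dotNr. Qed.

Lemma dotBl {F : rcfType} n (u v w : 'cV[F]_n) : dot (v - w) u = dot v u - dot w u.
Proof. by rewrite dotDl dotNl. Qed.

Lemma dot_sumr {F : rcfType} n I (r : seq I) (P : pred I) (u : 'cV[F]_n) f :
  dot u (\sum_(i <- r | P i) f i) = \sum_(i <- r | P i) dot u (f i).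
Proof. by rewrite /dot mulmx_sumr summxE. Qed.

Lemma dot_mulmxl {F : rcfType} m n (M : 'M[F]_(m, n)) u v :
  dot (M *m u) v = dot u (M^T *m v).
Proof. by rewrite /dot trmx_mul mulmxA. Qed.

Lemma dot_ge0 {F : rcfType} n (u : 'cV[F]_n) : 0 <= dot u u.
Proof. by rewrite dotE; apply: sumr_ge0 => i _; rewrite -expr2 sqr_ge0. Qed.

Lemma dot_eq0 {F : rcfType} n (u : 'cV[F]_n) : (dot u u == 0) = (u == 0).
Proof.
apply/idP/eqP => [|->]; last by rewrite /dot trmx0 mul0mx mxE.
rewrite dotE psumr_eq0 => [/allP u0|i _]; last by rewrite -expr2 sqr_ge0.
apply/matrixP => i j; rewrite (ord1 j) mxE; apply/eqP.
by have := u0 i (mem_index_enum _); rewrite -expr2 sqrf_eq0.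
Qed.

Lemma dot_gt0 {F : rcfType} n (u : 'cV[F]_n) : u != 0 -> 0 < dot u u.
Proof. by move=> u0; rewrite lt_def dot_eq0 u0 dot_ge0. Qed.

Lemma nrm_ge0 {F : rcfType} n (u : 'cV[F]_n) : 0 <= nrm u.
Proof. exact: sqrtr_ge0. Qed.
#[local] Hint Extern 0 (is_true (0 <= nrm _)) => exact: nrm_ge0 : core.
#[local] Hint Extern 0 (is_true (0 <= dot _ _)) => exact: dot_ge0 : core.

Lemma nrm_sqr {F : rcfType} n (u : 'cV[F]_n) : nrm u ^+ 2 = dot u u.
Proof. by rewrite sqr_sqrtr. Qed.

Lemma nrm_le_sqr {F : rcfType} n (u : 'cV[F]_n) (c : F) :
  0 <= c -> dot u u <= c ^+ 2 -> nrm u <= c.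
Proof. by move=> c0; rewrite -nrm_sqr ler_sqr ?nnegrE. Qed.

Lemma nrmN {F : rcfType} n (u : 'cV[F]_n) : nrm (- u) = nrm u.
Proof. by rewrite /nrm dotNl dotNr opprK. Qed.

Lemma CauchySchwarz_dot {F : rcfType} n (u v : 'cV[F]_n) :
  `|dot u v| <= nrm u * nrm v.
Proof.
have [->|v0] := eqVneq v 0.
  by rewrite /dot mulmx0 mxE normr0 mulr_ge0.
have vv := dot_gt0 v0.
rewrite -ler_sqr ?nnegrE ?mulr_ge0 // exprMn !nrm_sqr real_normK ?num_real //.
have := dot_ge0 (u - (dot u v / dot v v) *: v).
rewrite !(dotBl, dotBr, dotZl, dotZr) (dotC v u) => h.
rewrite -subr_ge0.
have -> : dot u u * dot v v - dot u v ^+ 2 =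
  (dot u u - dot u v / dot v v * dot u v - dot u v / dot v v *
   (dot u v - dot u v / dot v v * dot v v)) * dot v v.
  by field; rewrite gt_eqF.
by rewrite mulr_ge0.
Qed.

Lemma nrmD {F : rcfType} n (u v : 'cV[F]_n) : nrm (u + v) <= nrm u + nrm v.
Proof.
apply: nrm_le_sqr; first by rewrite addr_ge0.
rewrite !(dotDl, dotDr) (dotC v u) sqrrD !nrm_sqr.
have := CauchySchwarz_dot u v; have := ler_norm (dot u v); lra.
Qed.

(** With z = M^T y, |z|^2 = <M z, y> <= c |z| |y| by Cauchy-Schwarz, and a factor |z| cancels. *)
Lemma nrm_adjoint {F : rcfType} m n (M : 'M[F]_(m, n)) (c : F) : 0 <= c ->
  (forall x, nrm (M *m x) <= c * nrm x) -> forall y, nrm (M^T *m y) <= c * nrm y.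
Proof.
move=> c0 Mc y; set z := M^T *m y.
have [->|z0] := eqVneq (nrm z) 0; first by rewrite mulr_ge0.
have zp : 0 < nrm z by rewrite lt_def z0 nrm_ge0.
rewrite -(ler_pM2l zp) -expr2 nrm_sqr {2}/z -dot_mulmxl.
apply: le_trans (ler_norm _) _; apply: le_trans (CauchySchwarz_dot _ _) _.
by rewrite mulrCA mulrA ler_wpM2r.
Qed.

Lemma nrm_diag {F : rcfType} n (g : 'I_n -> F) (c : F) (x : 'cV[F]_n) : 0 <= c ->
  (forall j, `|g j| <= c) -> nrm (diag_mx (\row_j g j) *m x) <= c * nrm x.
Proof.
move=> c0 gc; apply: nrm_le_sqr; first by rewrite mulr_ge0.
rewrite exprMn nrm_sqr !dotE mulr_sumr; apply: ler_sum => j _.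
rewrite mul_diag_mx !mxE.
have -> : g j * x j 0 * (g j * x j 0) = `|g j| ^+ 2 * (x j 0 * x j 0).
  by rewrite real_normK ?num_real //; ring.
rewrite ler_wpM2r -?expr2 ?sqr_ge0 // lerXn2r ?nnegrE //.
Qed.

(** * Spectral theorem for real symmetric matrices *)

(** Take an eigenvector x + iy over the algebraically closed field F[i]. Symmetry of A, applied to
    <A x, y> = <x, A y>, gives Im a (|x|^2 + |y|^2) = 0, so the eigenvalue is real and x or y is a
    real eigenvector. *)
Lemma sym_eigenvector {F : rcfType} n (A : 'M[F]_n.+1) : A^T = A ->
  exists (a : F) (v : 'cV[F]_n.+1), v != 0 /\ A *m v = a *: v.
Proof.
move=> Asym.
have [a /eigenvalueP[v vA v0]] :=
  eigenvalue_closed (map_mx (real_complex F) A) (ltn0Sn n).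
pose x : 'cV[F]_n.+1 := \col_j complex.Re (v 0 j).
pose y : 'cV[F]_n.+1 := \col_j complex.Im (v 0 j).
have entry j : \sum_k v 0 k * (A k j)%:C%C = a * v 0 j.
  move/matrixP/(_ 0 j): vA; rewrite !mxE => <-.
  by apply: eq_bigr => k _; rewrite !mxE.
have Ajk j k : A j k = A k j by rewrite -{1}Asym mxE.
have Ax : A *m x = complex.Re a *: x - complex.Im a *: y.
  apply/matrixP => j i; rewrite (ord1 i) !mxE.
  have := congr1 (@complex.Re F) (entry j); rewrite raddf_sum.
  case: a {vA entry} => a b; case: (v 0 j) => c d /= <-.
  apply: eq_bigr => k _; rewrite !mxE Ajk.
  by case: (v 0 k) => s t /=; ring.
have Ay : A *m y = complex.Re a *: y + complex.Im a *: x.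
  apply/matrixP => j i; rewrite (ord1 i) !mxE.
  have := congr1 (@complex.Im F) (entry j); rewrite raddf_sum.
  case: a {vA entry Ax} => a b; case: (v 0 j) => c d /= <-.
  apply: eq_bigr => k _; rewrite !mxE Ajk.
  by case: (v 0 k) => s t /=; ring.
have xy0 : (x != 0) || (y != 0).
  rewrite -negb_and; apply: contra v0 => /andP[/eqP x0 /eqP y0].
  apply/eqP/matrixP => i j; rewrite (ord1 i) mxE; apply/eqP.
  move/matrixP/(_ j 0): x0; move/matrixP/(_ j 0): y0; rewrite !mxE.
  by case: (v 0 j) => s t /= -> ->.
have im0 : complex.Im a = 0.
  have := dot_mulmxl A x y; rewrite Asym Ax Ay.
  rewrite !(dotBl, dotBr, dotDl, dotDr, dotZl, dotZr) => h.
  have : complex.Im a * (dot x x + dot y y) = 0 by lra.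
  move/eqP; rewrite mulf_eq0 => /orP[/eqP//|].
  rewrite paddr_eq0 // !dot_eq0 => /andP[/eqP x0 /eqP y0].
  by rewrite x0 y0 eqxx in xy0.
rewrite im0 !scale0r subr0 in Ax; rewrite im0 scale0r addr0 in Ay.
by case/orP: xy0 => h; exists (complex.Re a); [exists x|exists y].
Qed.

(* Householder reflection along v / |v| - e_1. *)
Lemma orthogonal_first_col {F : rcfType} n (v : 'cV[F]_n.+1) : v != 0 ->
  exists (H : 'M[F]_n.+1) (b : F),
    H *m H = 1%:M /\ H^T = H /\ H *m delta_mx 0 0 = b *: v.
Proof.
move=> v0; set e : 'cV[F]_n.+1 := delta_mx 0 0.
have nv0 : nrm v != 0 by rewrite -sqrf_eq0 nrm_sqr dot_eq0.
pose u := (nrm v)^-1 *: v.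
have uu : dot u u = 1 by rewrite dotZl dotZr -nrm_sqr; field.
have ee : dot e e = 1.
  rewrite /dot trmx_delta mul_delta_mx mxE !eqxx //.
have [ue|ue] := eqVneq u e.
  exists 1%:M, (nrm v)^-1.
  by rewrite !mulmx1 trmx1 mul1mx -/u ue.
pose w := u - e; have w0 : w != 0 by rewrite subr_eq0.
have ww := dot_gt0 w0.
have wwE : w^T *m w = (dot w w)%:M by rewrite [LHS]mx11_scalar.
have weE : w^T *m e = (dot w e)%:M by rewrite [LHS]mx11_scalar.
pose c := 2 / dot w w.
exists (1%:M - c *: (w *m w^T)), (nrm v)^-1; rewrite -/u; split; last split.
- have XX : (w *m w^T) *m (w *m w^T) = dot w w *: (w *m w^T).
    rewrite mulmxA -[w *m w^T *m w]mulmxA wwE mul_mx_scalar.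
    by rewrite -scalemxAl.
  rewrite mulmxBl mul1mx mulmxBr mulmx1 -scalemxAl -scalemxAr XX !scalerA.
  have -> : c * c * dot w w = c + c.
    by rewrite /c; field; rewrite gt_eqF.
  by rewrite scalerDl opprB addrK subrK.
- by rewrite linearB /= linearZ /= trmx_mul trmxK trmx1.
- rewrite mulmxBl mul1mx -scalemxAl -mulmxA weE mul_mx_scalar scalerA.
  (* Since u and e are unit vectors, |u - e|^2 = 2 - 2<u, e> = -2<w, e>. *)
  have -> : c * dot w e = -1.
    rewrite /c.
    have : dot w w = - 2 * dot w e.
      rewrite !(dotBl, dotBr) uu ee (dotC e u); ring.
    move=> h.
    have we0 : dot w e != 0 by apply: contraTneq ww => h0; rewrite h h0 mulr0 ltxx.
    by rewrite h; field.
  by rewrite scaleN1r opprK addrC subrK.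
Qed.

(** Deflation: a reflection sending e_1 to a multiple of an eigenvector conjugates A to a symmetric
    matrix whose first column is a multiple of e_1. By symmetry it is block diagonal, and the
    induction hypothesis diagonalises the lower block. *)
Lemma real_spectral {F : rcfType} n (A : 'M[F]_n) : A^T = A ->
  exists (P : 'M[F]_n) (d : 'rV[F]_n),
    [/\ P *m P^T = 1%:M, P^T *m P = 1%:M & A = P^T *m diag_mx d *m P].
Proof.
elim: n A => [|n IHn] A Asym.
  by exists 1%:M, 0; split; apply/matrixP => -[].
have [a [v [v0 Av]]] := sym_eigenvector Asym.
have [H [b [HH [HT He]]]] := @orthogonal_first_col F n v v0.
pose A' := H *m A *m H.
have A'sym : A'^T = A' by rewrite /A' !trmx_mul HT Asym mulmxA.
have A'e : A' *m delta_mx 0 0 = a *: delta_mx 0 0 :> 'cV_n.+1.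
  rewrite /A' -mulmxA He -mulmxA -scalemxAr Av -[delta_mx 0 0 in RHS]mul1mx.
  by rewrite -HH -[H *m H *m _]mulmxA He -!scalemxAr scalerA mulrC -scalerA.
have AE : A = H *m A' *m H.
  by rewrite /A' !mulmxA HH mul1mx -mulmxA HH mulmx1.
clearbody A'.
have col0 i : A' i 0 = a *+ (i == 0).
  move/matrixP/(_ i 0): A'e; rewrite -colE !mxE => ->.
  by rewrite eqxx andbT mulr_natr.
have row0 i : A' 0 i = a *+ (i == 0) by rewrite -{1}A'sym mxE col0.
have l0 : lshift n (0 : 'I_1) = 0 by apply/val_inj.
have rn0 (j : 'I_n) : (rshift 1 j == 0) = false by [].
have A'E : A' = block_mx (a%:M : 'M_1) 0 0 (drsubmx (A' : 'M_(1 + n))) :> 'M_(1 + n).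
  apply: etrans (esym (@submxK F 1 n 1 n A')) _.
  congr block_mx; apply/matrixP => i j; rewrite !mxE.
  - by rewrite (ord1 i) (ord1 j) l0 col0 !eqxx.
  - by rewrite (ord1 i) l0 row0 rn0.
  - by rewrite (ord1 j) l0 col0 rn0.
have Bsym : (drsubmx (A' : 'M_(1 + n)))^T = drsubmx (A' : 'M_(1 + n)).
  by rewrite trmx_drsub A'sym.
have [P [d [PP PP' BE]]] := IHn _ Bsym.
pose P1 : 'M_(1 + n) := block_mx 1%:M 0 0 P.
have P1P : P1 *m P1^T = 1%:M.
  rewrite tr_block_mx !trmx0 trmx1 mulmx_block !(mulmx0, mul0mx, mulmx1).
  by rewrite PP !addr0 add0r -scalar_mx_block.
have A'd : A' = P1^T *m diag_mx (row_mx (a%:M : 'M_1) d) *m P1 :> 'M_(1 + n).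
  rewrite diag_mx_row tr_block_mx !trmx0 trmx1.
  rewrite !mulmx_block !(mulmx0, mul0mx, mulmx1, mul1mx) !addr0 !add0r.
  rewrite [LHS]A'E BE; congr block_mx; rewrite ?mul0mx //.
  by apply/matrixP => i j; rewrite !mxE (ord1 i) (ord1 j).
pose P2 : 'M[F]_n.+1 := P1; pose d2 : 'rV[F]_n.+1 := row_mx (a%:M : 'M_1) d.
exists (P2 *m H), d2; split.
- by rewrite trmx_mul mulmxA -[P2 *m H *m _]mulmxA HT HH mulmx1.
- rewrite trmx_mul mulmxA -[H^T *m _ *m P2]mulmxA (mulmx1C P1P) mulmx1.
  by rewrite HT.
- by rewrite [LHS]AE [A']A'd trmx_mul HT !mulmxA.
Qed.

(** * Functional calculus in an orthonormal eigenbasis *)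

(* The rows of P are an orthonormal eigenbasis, with eigenvalues g. *)
Definition spec {F : rcfType} {n} (P : 'M[F]_n) (g : 'I_n -> F) : 'M[F]_n :=
  P^T *m diag_mx (\row_j g j) *m P.

Lemma spec_sym {F : rcfType} n (P : 'M[F]_n) g : (spec P g)^T = spec P g.
Proof. by rewrite /spec !trmx_mul trmxK tr_diag_mx mulmxA. Qed.

Lemma eq_spec {F : rcfType} n (P : 'M[F]_n) g h : g =1 h -> spec P g = spec P h.
Proof.
move=> gh; rewrite /spec (_ : \row_j g j = \row_j h j) //.
by apply/rowP => j; rewrite !mxE.
Qed.

Lemma spec0 {F : rcfType} n (P : 'M[F]_n) : spec P (fun=> 0) = 0.
Proof.
rewrite /spec (_ : \row__ _ = 0) ?linear0 ?mulmx0 ?mul0mx //.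
by apply/rowP => j; rewrite !mxE.
Qed.

Lemma specB {F : rcfType} n (P : 'M[F]_n) g h :
  spec P (fun j => g j - h j) = spec P g - spec P h.
Proof.
rewrite /spec -mulmxBl -mulmxBr -linearB /=; congr (_ *m diag_mx _ *m _).
by apply/rowP => j; rewrite !mxE.
Qed.

Lemma mul_spec {F : rcfType} n (P : 'M[F]_n) g h : P *m P^T = 1%:M ->
  spec P g *m spec P h = spec P (fun j => g j * h j).
Proof.
move=> PP; rewrite /spec !mulmxA -[_ *m P *m P^T]mulmxA PP mulmx1.
rewrite -[P^T *m _ *m _]mulmxA mulmx_diag; congr (_ *m diag_mx _ *m _).
by apply/rowP => j; rewrite !mxE.
Qed.

Lemma spec1 {F : rcfType} n (P : 'M[F]_n) : P *m P^T = 1%:M ->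
  spec P (fun=> 1) = 1%:M.
Proof.
move=> PP; rewrite /spec (_ : \row__ _ = const_mx 1); last by apply/rowP => j; rewrite !mxE.
by rewrite diag_const_mx mulmx1 mulmx1C.
Qed.

Lemma dot_spec {F : rcfType} n (P : 'M[F]_n) g x :
  dot x (spec P g *m x) = \sum_j g j * (P *m x) j 0 ^+ 2.
Proof.
rewrite /spec -!mulmxA -{1}[P^T]trmxK -dot_mulmxl trmxK dotE.
by apply: eq_bigr => j _; rewrite mul_diag_mx [in RHS]expr2 !mxE mulrCA.
Qed.

Lemma dot_orthogonal {F : rcfType} m n (P : 'M[F]_(m, n)) x :
  P^T *m P = 1%:M -> dot (P *m x) (P *m x) = dot x x.
Proof. by move=> PP; rewrite dot_mulmxl mulmxA PP mul1mx. Qed.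

Lemma nrm_spec {F : rcfType} n (P : 'M[F]_n) (g : 'I_n -> F) (c : F) x :
  P *m P^T = 1%:M -> 0 <= c -> (forall j, `|g j| <= c) ->
  nrm (spec P g *m x) <= c * nrm x.
Proof.
move=> PP c0 gc.
have PP' := mulmx1C PP.
rewrite /spec -!mulmxA {1}/nrm (dot_orthogonal (P := P^T)) ?trmxK //.
have -> : nrm x = nrm (P *m x) by rewrite /nrm (dot_orthogonal (P := P)).
exact: nrm_diag.
Qed.

Lemma spectralP {F : rcfType} n (A : 'M[F]_n) : A^T = A ->
  exists (P : 'M[F]_n) (g : 'I_n -> F), P *m P^T = 1%:M /\ A = spec P g.
Proof.
move=> /real_spectral[P [d [PP _ ->]]]; exists P, (d 0); split=> //.
by rewrite /spec; congr (_ *m diag_mx _ *m _); apply/rowP => j; rewrite !mxE.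
Qed.

Lemma spec_eigenvector {F : rcfType} n (P : 'M[F]_n) g j : P *m P^T = 1%:M ->
  spec P g *m (P^T *m delta_mx j 0) = g j *: (P^T *m delta_mx j 0) :> 'cV_n.
Proof.
move=> PP; rewrite /spec -!mulmxA [P *m _]mulmxA PP mul1mx scalemxAr.
congr (_ *m _); apply/matrixP => i k; rewrite mul_diag_mx !mxE.
by have [->|] := eqVneq i j; rewrite //= !mulr0.
Qed.

(** The quadratic form is tested on the j-th eigenvector, the j-th column of [P^T]. *)
Lemma spec_range {F : rcfType} n (P : 'M[F]_n) g (a b : F) : P *m P^T = 1%:M ->
  (forall x, a * dot x x <= dot x (spec P g *m x) <= b * dot x x) ->
  forall j, a <= g j <= b.
Proof.
move=> PP h j; have := h (P^T *m delta_mx j 0).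
rewrite spec_eigenvector // dotZr (dot_orthogonal (P := P^T)) ?trmxK //.
rewrite /dot trmx_delta mul_delta_mx mxE !eqxx.
by rewrite !mulr1.
Qed.

(** For a symmetric matrix the quadratic form controls the norm, because it bounds every
    eigenvalue. *)
Lemma nrm_sym {F : rcfType} n (K : 'M[F]_n) (c : F) : K^T = K -> 0 <= c ->
  (forall x, `|dot x (K *m x)| <= c * dot x x) ->
  forall x, nrm (K *m x) <= c * nrm x.
Proof.
move=> /spectralP[P [g [PP ->]]] c0 Kc x; apply: nrm_spec => // j.
rewrite ler_norml; apply: (spec_range PP) => y.
by have := Kc y; rewrite ler_norml mulNr.
Qed.

(** The middle hypothesis says that h is a function of g. In the eigenbasis, commuting with
    [spec P g] means that the (i, j) entry of E vanishes unless g i = g j, and then h i = h j as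
    well. *)
Lemma spec_comm {F : rcfType} n (P : 'M[F]_n) (g h : 'I_n -> F) (E : 'M[F]_n) :
  P *m P^T = 1%:M -> (forall i j, g i = g j -> h i = h j) ->
  E *m spec P g = spec P g *m E -> E *m spec P h = spec P h *m E.
Proof.
move=> PP gh; have PP' := mulmx1C PP.
pose E' := P *m E *m P^T.
have conj f : P *m (E *m spec P f) *m P^T = E' *m diag_mx (\row_j f j).
  by rewrite /E' /spec !mulmxA -[_ *m P *m P^T]mulmxA PP mulmx1.
have conj' f : P *m (spec P f *m E) *m P^T = diag_mx (\row_j f j) *m E'.
  by rewrite /E' /spec !mulmxA PP mul1mx.
move=> EC.
have E'g : E' *m diag_mx (\row_j g j) = diag_mx (\row_j g j) *m E'.
  by rewrite -conj EC conj'.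
have E'h : E' *m diag_mx (\row_j h j) = diag_mx (\row_j h j) *m E'.
  clearbody E'; apply/matrixP => i j; move/matrixP/(_ i j): E'g.
  rewrite !mul_mx_diag !mul_diag_mx !mxE => /eqP.
  rewrite mulrC -subr_eq0 -mulrBl mulf_eq0 subr_eq0 => /orP[/eqP gij|/eqP->].
    by rewrite (gh _ _ gij) mulrC.
  by rewrite mulr0 mul0r.
have unconj M : M = P^T *m (P *m M *m P^T) *m P.
  by rewrite !mulmxA PP' mul1mx -mulmxA PP' mulmx1.
by rewrite [LHS]unconj [RHS]unconj conj conj' E'h.
Qed.

(** T is the positive square root of N. It is as close to the identity as N is, because |sqrt t - 1|
    = |t - 1| / (sqrt t + 1) <= |t - 1|. *)
Lemma near_id_sqrt {F : rcfType} n (N : 'M[F]_n) (b : F) : N^T = N ->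
  0 <= b -> b < 1 ->
  (forall x, `|dot x (N *m x) - dot x x| <= b * dot x x) ->
  exists T Ti : 'M[F]_n,
    [/\ T *m T = N, T^T = T /\ Ti^T = Ti, T *m Ti = 1%:M /\ Ti *m T = 1%:M,
        forall x, nrm (T *m x - x) <= b * nrm x
      & forall E, E *m N = N *m E -> E *m T = T *m E].
Proof.
move=> /spectralP[P [g [PP ->]]] b0 b1 Nb.
have gb : forall j, 1 - b <= g j <= 1 + b.
  apply: (spec_range PP) => x; have := Nb x; rewrite ler_norml => /andP[h1 h2].
  by apply/andP; split; lra.
have g0 j : 0 < g j by have /andP[h _] := gb j; lra.
have sg0 j : 0 < Num.sqrt (g j) by rewrite sqrtr_gt0.
have sgK j : Num.sqrt (g j) * Num.sqrt (g j) = g j.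
  by rewrite -expr2 sqr_sqrtr // ltW.
exists (spec P (fun j => Num.sqrt (g j))), (spec P (fun j => (Num.sqrt (g j))^-1)).
split.
- by rewrite mul_spec //; apply: eq_spec.
- by rewrite !spec_sym.
- rewrite !mul_spec // -(spec1 PP); split; apply: eq_spec => j.
    by rewrite mulfV // gt_eqF.
  by rewrite mulVf // gt_eqF.
- move=> x; rewrite -[X in _ - X]mul1mx -(spec1 PP) -mulmxBl -specB.
  apply: nrm_spec => // j.
  have /andP[h1 h2] := gb j; have h3 := sg0 j; have h4 := sgK j.
  rewrite ler_norml; apply/andP; split; nra.
- by move=> E; apply: spec_comm => // i j ->.
Qed.

(** * Approximation of a sketch by a partial isometry *)

Lemma nrm_proj {F : rcfType} n (E : 'M[F]_n) x : E^T = E -> E *m E = E ->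
  nrm (E *m x) <= nrm x.
Proof.
move=> ET EE; have [->|Ex0] := eqVneq (nrm (E *m x)) 0; first exact: nrm_ge0.
have Exp : 0 < nrm (E *m x) by rewrite lt_def Ex0 nrm_ge0.
rewrite -(ler_pM2l Exp) -expr2 nrm_sqr {1}dot_mulmxl ET mulmxA EE -{1}ET -dot_mulmxl.
by rewrite (le_trans (ler_norm _)) // (le_trans (CauchySchwarz_dot _ _)) // mulrC.
Qed.

Lemma nrm_partial_isometry {F : rcfType} k n (Q : 'M[F]_(k, n)) (E : 'M[F]_n) x :
  Q^T *m Q = E -> E *m E = E -> nrm (Q *m x) <= nrm x.
Proof.
move=> QQ EE; have ET : E^T = E by rewrite -QQ trmx_mul trmxK.
apply: nrm_le_sqr => //.
have -> : dot (Q *m x) (Q *m x) = dot (E *m x) (E *m x).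
  by rewrite !dot_mulmxl ET !mulmxA QQ EE.
by rewrite -nrm_sqr lerXn2r ?nnegrE // nrm_proj.
Qed.

(* W is the part of B E in the range of Q, small by near-orthogonality; Q' - Q
   is the polar part of M = B E - W, extended by the identity off E so that the
   square root T of M^T M + 1 - E is invertible. *)
Lemma extend_isometry {F : rcfType} k n (B : 'M[F]_(k, n)) (G E : 'M[F]_n)
    (al : F) (Q : 'M[F]_(k, n)) (X : 'M[F]_n) :
  G^T = G -> G *m G = G -> E^T = E -> E *m E = E -> G *m E = 0 ->
  0 <= al -> al <= 1 / 10 ->
  (forall x, (G + E) *m x = x ->
     `|dot (B *m x) (B *m x) - dot x x| <= al * dot x x) ->
  Q^T *m Q = G -> Q *m G = Q -> Q = B *m X -> G *m X = X ->
  exists (Q' : 'M[F]_(k, n)) (X' : 'M[F]_n),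
    [/\ Q'^T *m Q' = G + E, Q' *m (G + E) = Q',
        Q' = B *m X' /\ (G + E) *m X' = X', Q' *m G = Q
      & forall x, nrm ((B - Q') *m (E *m x)) <= 4 * al * nrm x].
Proof.
move=> GT GG ET EE GE al0 al1 Bemb QQ QG QBX GX.
have EG : E *m G = 0 by rewrite -[LHS]trmxK trmx_mul GT ET GE trmx0.
have GQ : G *m Q^T = Q^T by rewrite -{1}GT -trmx_mul QG.
have QE : Q *m E = 0 by rewrite -QG -mulmxA GE mulmx0.
pose H := G + E.
have HT : H^T = H by rewrite linearD /= GT ET.
have HH : H *m H = H by rewrite mulmxDl !mulmxDr GG EE GE EG addr0 add0r.
have HE : H *m E = E by rewrite mulmxDl GE EE add0r.
have HG : H *m G = G by rewrite mulmxDl GG EG addr0.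
(* [K] is the isometry defect of B compressed to the range of H; the embedding hypothesis bounds its
   quadratic form, hence its norm, by al. *)
pose K := H *m (B^T *m B - 1%:M) *m H.
have KT : K^T = K.
  by rewrite /K !trmx_mul HT linearB /= trmx_mul trmxK trmx1 mulmxA.
have Kx x : nrm (K *m x) <= al * nrm x.
  apply: nrm_sym => // y.
  have -> : dot y (K *m y) = dot (B *m (H *m y)) (B *m (H *m y)) - dot (H *m y) (H *m y).
    rewrite /K -!mulmxA -{1}HT -dot_mulmxl mulmxBl mul1mx dotBr.
    by rewrite [in RHS]dot_mulmxl mulmxA.
  apply: le_trans (Bemb _ _) _; first by rewrite mulmxA HH.
  rewrite ler_wpM2l // -!nrm_sqr lerXn2r ?nnegrE //.
  exact: nrm_proj.
pose W := Q *m Q^T *m B *m E.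
(* Writing W = B Z with Z valued in the range of G makes the embedding hypothesis available for
   vectors W x. *)
pose Z := X *m Q^T *m B *m E.
have WBZ : W = B *m Z by rewrite /W /Z {1}QBX !mulmxA.
have GZ : G *m Z = Z by rewrite /Z !mulmxA GX.
have HZ : H *m Z = Z by rewrite -GZ mulmxA HG.
have WW : Q *m Q^T *m W = W.
  by rewrite /W !mulmxA -[Q *m Q^T *m Q]mulmxA QQ QG.
have Wx x : nrm (W *m x) <= 2 * al * nrm (E *m x).
  set w := W *m x; set z := Z *m x.
  have wz : w = B *m z by rewrite /w /z WBZ mulmxA.
  have Hz : H *m z = z by rewrite /z mulmxA HZ.
  have Gz : G *m z = z by rewrite /z mulmxA GZ.
  have wle : nrm w ^+ 2 <= nrm z * (al * nrm (E *m x)).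
    (* [Q Q^T] fixes w, so |w|^2 = <w, B E x> = <B z, B E x>. As z lies in the range of G, it is
       orthogonal to E x, and only the defect [K] remains. *)
    have -> : nrm w ^+ 2 = dot z (K *m (E *m x)).
      have -> : nrm w ^+ 2 = dot w (B *m (E *m x)).
        have wE : w = Q *m Q^T *m (B *m (E *m x)) by rewrite /w /W !mulmxA.
        have Sw : Q *m Q^T *m w = w by rewrite /w mulmxA WW.
        by rewrite nrm_sqr {2}wE [RHS]dotC [LHS]dotC dot_mulmxl trmx_mul trmxK Sw.
      rewrite wz dot_mulmxl /K -!mulmxA [H *m (E *m x)]mulmxA HE.
      rewrite -[in RHS]HT -(dot_mulmxl H) Hz mulmxBl mul1mx dotBr.
      have -> : dot z (E *m x) = 0.
        by rewrite -Gz dot_mulmxl GT mulmxA GE mul0mx /dot mulmx0 mxE.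
      by rewrite subr0 mulmxA.
    apply: le_trans (ler_norm _) _; apply: le_trans (CauchySchwarz_dot _ _) _.
    by rewrite ler_wpM2l.
  (* The embedding at z gives (1 - al) |z|^2 <= |w|^2, with 1 - al >= 9/10. *)
  have zw : nrm z <= 2 * nrm w.
    apply: nrm_le_sqr; first by rewrite mulr_ge0.
    rewrite exprMn nrm_sqr; have := Bemb z Hz; rewrite -wz ler_norml.
    have := dot_ge0 z; have := dot_ge0 w; nra.
  have [->|w0] := eqVneq (nrm w) 0; first by rewrite !mulr_ge0.
  have wp : 0 < nrm w by rewrite lt_def w0 nrm_ge0.
  rewrite -(ler_pM2l wp) -expr2; apply: le_trans wle _.
  have := ler_wpM2r (mulr_ge0 al0 (nrm_ge0 (E *m x))) zw; lra.
pose M := B *m E - W.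
have ME : M *m E = M by rewrite /M /W mulmxBl -!mulmxA EE.
have QM : Q^T *m M = 0.
  by rewrite /M /W mulmxBr !mulmxA QQ GQ subrr.
have MQ : M^T *m Q = 0 by rewrite -[LHS]trmxK trmx_mul trmxK QM trmx0.
have MW : M^T *m W = 0 by rewrite /W !mulmxA MQ !mul0mx.
pose N0 := M^T *m M.
have N0E : N0 *m E = N0 by rewrite /N0 -mulmxA ME.
have EN0 : E *m N0 = N0 by rewrite /N0 -{1}ET mulmxA -trmx_mul ME.
pose N := N0 + (1%:M - E).
have NT : N^T = N.
  have N0T : N0^T = N0 by rewrite /N0 trmx_mul trmxK.
  by rewrite /N linearD /= N0T linearB /= trmx1 ET.
have NE : N *m E = N0 by rewrite /N mulmxDl N0E mulmxBl mul1mx EE subrr addr0.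
have EN : E *m N = N0 by rewrite /N mulmxDr EN0 mulmxBr mulmx1 EE subrr addr0.
have Nx x : `|dot x (N *m x) - dot x x| <= 2 * al * dot x x.
  have Exx : dot (E *m x) (E *m x) <= dot x x.
    by rewrite -!nrm_sqr lerXn2r ?nnegrE // nrm_proj.
  have hM : dot (M *m x) (M *m x) =
      dot (B *m (E *m x)) (B *m (E *m x)) - dot (W *m x) (W *m x).
    have MWx : dot (M *m x) (W *m x) = 0.
      by rewrite dot_mulmxl mulmxA MW mul0mx /dot mulmx0 mxE.
    have -> : B *m (E *m x) = M *m x + W *m x by rewrite -mulmxDl /M subrK mulmxA.
    by rewrite !(dotDl, dotDr) (dotC (W *m x) (M *m x)) MWx; ring.
  have -> : dot x (N *m x) - dot x x =
     dot (B *m (E *m x)) (B *m (E *m x)) - dot (E *m x) (E *m x)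
       - dot (W *m x) (W *m x).
    rewrite /N /N0 mulmxDl mulmxBl mul1mx dotDr dotBr -mulmxA -dot_mulmxl hM.
    have -> : dot (E *m x) (E *m x) = dot x (E *m x) by rewrite dot_mulmxl ET mulmxA EE.
    by ring.
  have hB : H *m (E *m x) = E *m x by rewrite mulmxA HE.
  have := Bemb _ hB.
  have hW : dot (W *m x) (W *m x) <= 4 * al ^+ 2 * dot (E *m x) (E *m x).
    rewrite -!nrm_sqr (_ : 4 * al ^+ 2 * _ = (2 * al * nrm (E *m x)) ^+ 2); last by ring.
    by rewrite lerXn2r ?nnegrE ?mulr_ge0.
  have := dot_ge0 (W *m x); have := dot_ge0 (E *m x); have := Exx.
  (* B contributes al to the defect of N and W contributes 4 al^2 <= (2/5) al, which together stay
     below 2 al. *)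
  have hal : al ^+ 2 <= al / 10 by nra.
  move: hW; set a := dot (E *m x) _; set b := dot (W *m x) _; set c := dot x x.
  set e := dot (B *m _) _ => hW ac a0 b0.
  have hW' : b <= 4 * (al / 10) * a by nra.
  rewrite !ler_norml => /andP[h1 h2]; apply/andP; split; nra.
have [|| T [Ti [TT [TsT TiT] [TTi TiT1] Tx Tcomm]]] := near_id_sqrt NT _ _ Nx.
- by rewrite mulr_ge0.
- lra.
(* E commutes with N, hence with T and with its inverse; so the polar factor M T^-1 still vanishes
   off the range of E. *)
have ETc : E *m T = T *m E by apply: Tcomm; rewrite EN NE.
have ETi : E *m Ti = Ti *m E.
  by rewrite -[LHS]mul1mx -TiT1 -!mulmxA [T *m _]mulmxA -ETc -mulmxA TTi mulmx1.
pose R0 := M *m Ti.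
have R0E : R0 *m E = R0 by rewrite /R0 -mulmxA -ETi mulmxA ME.
have R0T : R0 *m T = M by rewrite /R0 -mulmxA TiT1 mulmx1.
have QR0 : Q^T *m R0 = 0 by rewrite /R0 mulmxA QM mul0mx.
have R0Q : R0^T *m Q = 0 by rewrite -[LHS]trmxK trmx_mul trmxK QR0 trmx0.
have R0R0 : R0^T *m R0 = E.
  rewrite /R0 trmx_mul TiT -mulmxA [M^T *m _]mulmxA -/N0 -NE -TT.
  by rewrite !mulmxA TiT1 mul1mx -ETc -mulmxA TTi mulmx1.
have R0G : R0 *m G = 0 by rewrite -R0E -mulmxA EG mulmx0.
(* B (E - Z) = B E - W = M, so the second witness satisfies B X' = Q + M T^-1. *)
exists (Q + R0), (X + (E - Z) *m Ti); split.
- have -> : (Q + R0)^T = Q^T + R0^T by rewrite linearD.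
  by rewrite mulmxDl !mulmxDr QQ QR0 R0Q R0R0 addr0 add0r.
- by rewrite mulmxDl !mulmxDr QG QE R0G R0E addr0 add0r.
- split.
    by rewrite mulmxDr -QBX mulmxA mulmxBr -WBZ.
  by rewrite mulmxDr mulmxA mulmxBr -/H HE HZ -GX [H *m (G *m X)]mulmxA HG.
- by rewrite mulmxDl QG R0G addr0.
- move=> x.
  (* Q vanishes on the range of E and B E = W + R0 T, so the error is W plus R0 (T - 1) E. Each term
     has norm at most 2 al. *)
  have -> : (B - (Q + R0)) *m (E *m x) = W *m x + R0 *m (T *m (E *m x) - E *m x).
    have BQE : (B - (Q + R0)) *m E = W + (M - R0).
      by rewrite mulmxBl mulmxDl QE add0r R0E /M addrA [W + _]addrC subrK.
    by rewrite mulmxBr !mulmxA R0T ME R0E BQE -mulmxBl -mulmxDl.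
  apply: le_trans (nrmD _ _) _.
  have h1 := Wx x; have h2 := nrm_proj x ET EE.
  have h3 := nrm_partial_isometry (T *m (E *m x) - E *m x) R0R0 EE.
  have h4 := Tx (E *m x).
  have h5 : 2 * al * nrm (E *m x) <= 2 * al * nrm x by rewrite ler_wpM2l // mulr_ge0.
  lra.
Qed.

(* The induction also carries Q = B X: the range of Q lies in that of B G_r, where
   the embedding hypothesis can be applied. *)
Lemma near_isometry_chain {F : rcfType} k n (B : 'M[F]_(k, n))
    (G : nat -> 'M[F]_n) (al : nat -> F) m :
  G 0%N = 0 -> (forall r, (G r)^T = G r) ->
  (forall r s, (r <= s)%N -> G r *m G s = G r) ->
  (forall r, (r < m)%N -> 0 <= al r <= 1 / 10) ->
  (forall r, (r < m)%N -> forall x, G r.+1 *m x = x ->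
     `|dot (B *m x) (B *m x) - dot x x| <= al r * dot x x) ->
  exists Q : 'M[F]_(k, n),
    [/\ Q^T *m Q = G m, Q *m G m = Q
      & forall r, (r < m)%N -> forall x,
          nrm ((B - Q) *m ((G r.+1 - G r) *m x)) <= 4 * al r * nrm x].
Proof.
move=> G0 GT GG alb emb.
have GG' r s : (r <= s)%N -> G s *m G r = G r.
  by move=> rs; rewrite -[LHS]trmxK trmx_mul !GT GG // GT.
suff [Q [X [? ? _ _ ?]]] : exists (Q : 'M[F]_(k, n)) (X : 'M[F]_n),
    [/\ Q^T *m Q = G m, Q *m G m = Q, Q = B *m X, G m *m X = X
      & forall r, (r < m)%N -> forall x,
          nrm ((B - Q) *m ((G r.+1 - G r) *m x)) <= 4 * al r * nrm x].
  by exists Q.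
elim: m alb emb => [|m IHm] alb emb.
  exists 0, 0; split=> //; rewrite ?G0 ?mulmx0 ?mul0mx //.
have [||Q [X [QQ QG QBX GX Qal]]] := IHm.
- by move=> r rm; apply: alb; apply: ltnW.
- by move=> r rm; apply: emb; apply: ltnW.
pose E := G m.+1 - G m.
have ET : E^T = E by rewrite linearB /= !GT.
have EE : E *m E = E.
  rewrite /E mulmxBl !mulmxBr !(GG _ _ (leqnn _)) (GG _ _ (leqnSn m)).
  by rewrite (GG' _ _ (leqnSn m)) subrr subr0.
have GE : G m *m E = 0 by rewrite mulmxBr (GG _ _ (leqnn m)) (GG _ _ (leqnSn m)) subrr.
have GDE : G m + E = G m.+1 by rewrite addrC subrK.
have /andP[al0 al1] := alb m (ltnSn m).
have [|Q' [X' [QQ' QG' [QBX' GX'] Q'G Q'E]]] :=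
  @extend_isometry F k n B (G m) E (al m) Q X (GT m) (GG _ _ (leqnn m))
    ET EE GE al0 al1 _ QQ QG QBX GX.
  by move=> x; rewrite GDE; apply: emb.
rewrite GDE in QQ' QG' GX'.
exists Q', X'; split=> // r; rewrite ltnS leq_eqVlt => /orP[/eqP->|rm] x.
  exact: Q'E.
have Er : G m *m (G r.+1 - G r) = G r.+1 - G r.
  by rewrite mulmxBr (GG' _ _ rm) (GG' _ _ (ltnW rm)).
(* Earlier levels lie in the range of [G m], where Q' agrees with Q, so their bounds persist. *)
have Q'r : Q' *m (G r.+1 - G r) = Q *m (G r.+1 - G r).
  by rewrite -Er !mulmxA Q'G QG.
rewrite mulmxA mulmxBl Q'r -mulmxBl -mulmxA.
exact: Qal.
Qed.

(** By symmetry of A, <p, A p> - <q, A q> = <p - q, A (p + q)>. Passing to adjoints, |p - q| <= 4 al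
    |y| and |p + q| <= (4/10 + 2) |y|; the product of the constants is 48/5 <= 10. *)
Lemma sandwich_perturbation {F : rcfType} k n (B Q : 'M[F]_(k, n))
    (E A : 'M[F]_n) (al c : F) :
  E^T = E -> E *m E = E -> A^T = A -> E *m A *m E = A -> 0 <= al -> al <= 1 / 10 ->
  0 <= c -> (forall x, nrm (A *m x) <= c * nrm x) ->
  (forall x, nrm (Q *m x) <= nrm x) ->
  (forall x, nrm ((B - Q) *m (E *m x)) <= 4 * al * nrm x) ->
  forall y, `|dot (B^T *m y) (A *m (B^T *m y)) - dot (Q^T *m y) (A *m (Q^T *m y))|
    <= 10 * c * al * dot y y.
Proof.
move=> ET EE AT EAE al0 al1 c0 Ac Q1 BQ y.
pose p := E *m (B^T *m y); pose q := E *m (Q^T *m y).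
have qf u : dot u (A *m u) = dot (E *m u) (A *m (E *m u)).
  by rewrite [RHS]dot_mulmxl ET -[in LHS]EAE -!mulmxA.
have qy : nrm q <= nrm y.
  apply: le_trans (nrm_proj _ ET EE) _; rewrite -[nrm y]mul1r.
  by apply: nrm_adjoint => // x; rewrite mul1r.
have pq : nrm (p - q) <= 4 * al * nrm y.
  have -> : p - q = ((B - Q) *m E)^T *m y.
    by rewrite trmx_mul ET [(B - Q)^T]linearB /= /p /q !mulmxA mulmxBr mulmxBl.
  by apply: nrm_adjoint => [|x]; rewrite ?mulr_ge0 // -mulmxA.
have pq' : nrm (p + q) <= 12 / 5 * nrm y.
  have -> : p + q = (p - q) + (q + q) by rewrite addrA subrK.
  apply: le_trans (nrmD _ _) _; have := nrmD q q.
  have : 4 * al * nrm y <= 2 / 5 * nrm y by rewrite ler_wpM2r //; lra.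
  lra.
rewrite qf [X in _ - X]qf -/p -/q.
have -> : dot p (A *m p) - dot q (A *m q) = dot (p - q) (A *m (p + q)).
  rewrite mulmxDr !(dotDr, dotBl).
  have -> : dot q (A *m p) = dot p (A *m q) by rewrite dotC dot_mulmxl AT.
  by ring.
apply: le_trans (CauchySchwarz_dot _ _) _.
have h1 := ler_wpM2l c0 pq'.
have h2 := ler_pM (nrm_ge0 _) (nrm_ge0 _) pq (le_trans (Ac _) h1).
apply: le_trans h2 _; rewrite -nrm_sqr.
have : 0 <= c * al * nrm y ^+ 2 by rewrite !mulr_ge0.
have -> : 4 * al * nrm y * (c * (12 / 5 * nrm y)) = 48 / 5 * (c * al * nrm y ^+ 2) by field.
by lra.
Qed.

(** * Eigenvalue counting *)

(** If J were larger than I, the |I| linear conditions would have a nonzero solution supported on J.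
    The submatrix [C'] is transposed because [kermx] consists of row vectors. *)
Lemma leq_card_supports {F : fieldType} k n (C : 'M[F]_(k, n))
    (I : {set 'I_k}) (J : {set 'I_n}) :
  (forall x : 'cV[F]_n, (forall j, j \notin J -> x j 0 = 0) ->
     (forall i, i \in I -> (C *m x) i 0 = 0) -> x = 0) ->
  (#|J| <= #|I|)%N.
Proof.
move=> inj; rewrite leqNgt; apply/negP => ltIJ.
pose C' : 'M[F]_(#|J|, #|I|) := \matrix_(a, b) C (enum_val b) (enum_val a).
have : kermx C' != 0.
  rewrite -mxrank_eq0 mxrank_ker -lt0n subn_gt0.
  by apply: leq_ltn_trans ltIJ; apply: rank_leq_col.
case/rowV0Pn => u /sub_kermxP uC u0.
pose x : 'cV[F]_n := \sum_a u 0 a *: delta_mx (enum_val a) 0.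
have xE a : x (enum_val a) 0 = u 0 a.
  rewrite summxE (bigD1 a) //= !mxE !eqxx mulr1 big1 ?addr0 // => b ba.
  rewrite !mxE (inj_eq enum_val_inj) eq_sym (negPf ba) mulr0 //.
have x0 : x = 0.
  apply: inj => [j jJ|i iI].
    rewrite summxE big1 // => a _; rewrite !mxE.
    case: eqP => [ja|]; last by rewrite mulr0.
    by rewrite ja enum_valP in jJ.
  have {}uC : \sum_a u 0 a * C' a (enum_rank_in iI i) = 0.
    by move/matrixP/(_ 0 (enum_rank_in iI i)): uC; rewrite !mxE.
  rewrite /x mulmx_sumr summxE -[RHS]uC; apply: eq_bigr => a _.
  by rewrite -scalemxAr -colE !mxE enum_rankK_in.
case/negP: u0; apply/eqP/rowP => a; by rewrite -xE x0 !mxE.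
Qed.

Lemma dot_spec_ge {F : rcfType} n (P : 'M[F]_n) d (a : F) x : P *m P^T = 1%:M ->
  (forall j, d j < a -> (P *m x) j 0 = 0) -> a * dot x x <= dot x (spec P d *m x).
Proof.
move=> PP dx; rewrite dot_spec -(dot_orthogonal x (mulmx1C PP)) dotE mulr_sumr.
apply: ler_sum => j _; rewrite -expr2.
have [dj|dj] := ltP (d j) a; first by rewrite dx // expr0n !mulr0.
by rewrite ler_wpM2r ?sqr_ge0.
Qed.

Lemma dot_spec_le {F : rcfType} n (P : 'M[F]_n) d (a : F) x : P *m P^T = 1%:M ->
  (forall j, a <= d j -> (P *m x) j 0 = 0) -> dot x (spec P d *m x) <= a * dot x x.
Proof.
move=> PP dx; rewrite dot_spec -(dot_orthogonal x (mulmx1C PP)) dotE mulr_sumr.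
apply: ler_sum => j _; rewrite -expr2.
have [dj|dj] := leP a (d j); first by rewrite dx // expr0n !mulr0.
by rewrite ler_wpM2r ?sqr_ge0 // ltW.
Qed.

(** Let x' be spanned by eigenvectors of eigenvalue at least a. As a > 0, [Q^T Q] fixes x', so y = Q
    x' has the norm of x' and Q^T y = x'. The form of [spec U e] at y is then at least (a - eps)
    |y|^2; if the coordinates of y with s <= e i vanish, it is at most s |y|^2, which forces y =
    0. *)
Lemma card_spec_lower {F : rcfType} k n (P : 'M[F]_n) (d : 'I_n -> F)
    (U : 'M[F]_k) (e : 'I_k -> F)
    (Q : 'M[F]_(k, n)) (eps a s : F) :
  P *m P^T = 1%:M -> U *m U^T = 1%:M ->
  Q^T *m Q = spec P (fun j => (d j != 0)%:R) ->
  (forall y, `|dot y (spec U e *m y) - dot (Q^T *m y) (spec P d *m (Q^T *m y))|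
     <= eps * dot y y) ->
  0 < a -> s + eps < a ->
  (#|[set j | (a <= d j)%R]| <= #|[set i | (s <= e i)%R]|)%N.
Proof.
move=> PP UU QQ qf a0 sa; apply: (@leq_card_supports F k n (U *m Q *m P^T)).
move=> x xJ xI; apply/eqP; rewrite -dot_eq0; apply/eqP.
pose x' := P^T *m x; pose y := Q *m x'.
have Px' : P *m x' = x by rewrite mulmxA PP mul1mx.
have Qy : Q^T *m y = x'.
  rewrite mulmxA QQ /spec -!mulmxA Px'; congr (_ *m _).
  apply/matrixP => j l; rewrite mul_diag_mx !mxE (ord1 l).
  have [aj|aj] := leP a (d j); first by rewrite gt_eqF ?mul1r // (lt_le_trans a0).
  by rewrite xJ ?mulr0 // inE -ltNge.
have xx : dot x x = dot x' x'.
  by rewrite (dot_orthogonal (P := P^T)) // trmxK.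
have yy : dot y y = dot x x by rewrite xx dot_mulmxl Qy.
have h1 : a * dot x x <= dot x' (spec P d *m x').
  rewrite xx; apply: dot_spec_ge => // j ja; rewrite Px' xJ // inE -ltNge //.
have h2 : dot y (spec U e *m y) <= s * dot x x.
  rewrite -yy; apply: dot_spec_le => // i ie.
  by rewrite !mulmxA xI // inE.
have := qf y; rewrite Qy ler_norml yy => /andP[h3 _].
have := dot_ge0 x; nra.
Qed.

(** The reverse count starts from an arbitrary y, for which [Q^T] is only a contraction; s >= 0
    gives s |Q^T y|^2 <= s |y|^2. *)
Lemma card_spec_upper {F : rcfType} k n (P : 'M[F]_n) (d : 'I_n -> F)
    (U : 'M[F]_k) (e : 'I_k -> F)
    (Q : 'M[F]_(k, n)) (eps t s : F) :
  P *m P^T = 1%:M -> U *m U^T = 1%:M ->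
  (forall x, nrm (Q *m x) <= nrm x) ->
  (forall y, `|dot y (spec U e *m y) - dot (Q^T *m y) (spec P d *m (Q^T *m y))|
     <= eps * dot y y) ->
  0 <= s -> s + eps < t ->
  (#|[set i | (t <= e i)%R]| <= #|[set j | (s <= d j)%R]|)%N.
Proof.
move=> PP UU Q1 qf s0 st; apply: (@leq_card_supports F n k (P *m Q^T *m U^T)).
move=> z zI zJ; apply/eqP; rewrite -dot_eq0; apply/eqP.
pose y := U^T *m z.
have Uy : U *m y = z by rewrite mulmxA UU mul1mx.
have yy : dot y y = dot z z by rewrite (dot_orthogonal (P := U^T)) // trmxK.
have h1 : t * dot y y <= dot y (spec U e *m y).
  apply: dot_spec_ge => // i ie; rewrite Uy zI // inE -ltNge //.
have h2 : dot (Q^T *m y) (spec P d *m (Q^T *m y)) <= s * dot (Q^T *m y) (Q^T *m y).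
  by apply: dot_spec_le => // j jd; rewrite !mulmxA zJ // inE.
have h3 : dot (Q^T *m y) (Q^T *m y) <= dot y y.
  rewrite -!nrm_sqr lerXn2r ?nnegrE // -[nrm y]mul1r.
  by apply: nrm_adjoint => // x; rewrite mul1r.
have h4 := ler_wpM2l s0 h3.
have := qf y; rewrite ler_norml => /andP[_ h5].
have := dot_ge0 z; rewrite -yy; nra.
Qed.

(** * Ordered eigenvalues read off a spectral decomposition *)

Lemma char_poly_spec {F : rcfType} n (P : 'M[F]_n) g : P *m P^T = 1%:M ->
  char_poly (spec P g) = \prod_(j < n) ('X - (g j)%:P).
Proof.
move=> /mulmx1C PP; pose D := diag_mx (\row_j g j); pose Pc := map_mx polyC P.
have PcPc : Pc^T *m Pc = 1%:M by rewrite map_trmx -map_mxM PP map_mx1.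
have -> : char_poly (spec P g) = char_poly D.
  have cE : char_poly_mx (spec P g) = Pc^T *m char_poly_mx D *m Pc.
    rewrite /char_poly_mx /spec !map_mxM -map_trmx mulmxBr mulmxBl.
    by rewrite mul_mx_scalar -scalemxAl PcPc scalemx1.
  by rewrite /char_poly cE !det_mulmx mulrAC -det_mulmx PcPc det1 mul1r.
rewrite char_poly_trig ?diag_mx_is_trig //.
by apply: eq_bigr => j _; rewrite !mxE eqxx.
Qed.

(** [eig_list] is obtained by choice; unique factorisation of the characteristic polynomial
    determines it up to permutation. *)
Lemma eig_list_spec n (P : 'M[R]_n) g : P *m P^T = 1%:M ->
  perm_eq (eig_list (spec P g)) [seq g j | j <- enum 'I_n].
Proof.
move=> PP; have gE : char_poly (spec P g) =
    \prod_(x <- [seq g j | j <- enum 'I_n]) ('X - x%:P).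
  by rewrite big_map big_enum char_poly_spec.
rewrite /eig_list; case: pselect => [H|[]]; last by exists [seq g j | j <- enum 'I_n].
by apply: prod_XsubC_eq; rewrite -gE; case: cid.
Qed.

Lemma size_eig_list_spec n (P : 'M[R]_n) g : P *m P^T = 1%:M ->
  size (eig_list (spec P g)) = n.
Proof. by move=> PP; rewrite (perm_size (eig_list_spec g PP)) size_map size_enum_ord. Qed.

Lemma nth_sorted_ge (s : seq R) (t : R) i : sorted (fun x y : R => y <= x) s ->
  (i < size s)%N -> (t <= nth 0 s i) = (i < count (fun x => (t <= x)%R) s)%N.
Proof.
have tr : transitive (fun x y : R => y <= x) by move=> y x z xy yz; apply: le_trans yz xy.
elim: s i => // x s IHs i /= sxs.
have sle : all (fun y => y <= x) s by move: sxs; rewrite path_sortedE // => /andP[].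
have ss : sorted (fun x y : R => y <= x) s by apply: path_sorted sxs.
have [tx|tx] := leP t x; last first.
  have c0 : count (fun x => (t <= x)%R) s = 0%N.
    apply/eqP; rewrite -leqn0 leqNgt -has_count; apply/negP => /hasP[y ys ty].
    by have := lt_le_trans tx ty; rewrite ltNge (allP sle).
  have tx' : (t <= x) = false by rewrite leNgt tx.
  rewrite /= c0; case: i => [|i] /= si; first by rewrite tx'.
  by apply/negbTE; rewrite -ltNge; apply: le_lt_trans tx; apply: (allP sle); apply: mem_nth.
by case: i => [|i] /= si; rewrite ?tx // add1n ltnS IHs.
Qed.

(** This turns bounds on an ordered eigenvalue into the cardinalities that the dimension counts
    compare. The range of i keeps [nth] off its default value. *)
Lemma le_lambda n (P : 'M[R]_n) g t i : P *m P^T = 1%:M ->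
  (0 < i)%N -> (i <= n)%N ->
  (t <= lambda_ (spec P g) i) = (i <= #|[set j | (t <= g j)%R]|)%N.
Proof.
move=> PP i0 iN; have tot : total (fun x y : R => y <= x) by move=> x y; apply: le_total.
rewrite /lambda_ nth_sorted_ge ?sort_sorted //; last first.
  by rewrite size_sort size_eig_list_spec // prednK.
rewrite prednK // count_sort (permP (eig_list_spec g PP)) count_map.
rewrite -sum1_card -sum1_count big_enum_cond /=; congr (_ <= _)%N.
by apply: eq_bigl => j; rewrite inE.
Qed.

(** Past the end of the list [nth] returns 0, which is not positive. *)
Lemma lambda_gt0_le n (P : 'M[R]_n) g i : P *m P^T = 1%:M ->
  (0 < i)%N -> 0 < lambda_ (spec P g) i -> (i <= n)%N.
Proof.
move=> PP i0; rewrite /lambda_; apply: contraTT; rewrite -ltnNge => ni.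
by rewrite nth_default ?ltxx // size_sort size_eig_list_spec // -ltnS prednK.
Qed.

(** Negation carries the increasing ordering of the eigenvalues to the decreasing ordering of their
    opposites; out of range both sides are the default 0. *)
Lemma mu_lambdaN n (P : 'M[R]_n) g i : P *m P^T = 1%:M ->
  mu_ (spec P g) i = - lambda_ (- spec P g) i.
Proof.
move=> PP; have NE : - spec P g = spec P (fun j => - g j).
  by rewrite -[LHS]sub0r -(spec0 P) -specB; apply: eq_spec => j; rewrite sub0r.
rewrite /mu_ /lambda_ NE.
set s := eig_list (spec P g); set s' := eig_list _.
have -> : sort (fun x y : R => y <= x) s' = [seq - x | x <- sort (fun x y : R => x <= y) s].
  apply: (@sorted_eq _ (fun x y : R => y <= x)).
  - by move=> y x z xy yz; apply: le_trans yz xy.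
  - by move=> x y /andP[h1 h2]; apply/le_anti; rewrite h1 h2.
  - by apply: sort_sorted => x y; apply: le_total.
  - rewrite sorted_map; apply: sub_sorted (sort_le_sorted s) => x y /=.
    by rewrite lerN2.
  - rewrite perm_sort (perm_trans (eig_list_spec _ PP)) //.
    rewrite (map_comp -%R g) perm_map // perm_sym perm_sort.
    exact: eig_list_spec.
set u := sort _ s; have [iu|iu] := ltnP i.-1 (size u).
  by rewrite (nth_map 0) // opprK.
by rewrite !nth_default ?size_map // oppr0.
Qed.

(** * Operator norm, eigenspaces and dyadic scales *)

Lemma vnormE n (v : 'cV[R]_n) : vnorm v = nrm v.
Proof. by rewrite /vnorm /nrm dotE; congr Num.sqrt; apply: eq_bigr => i _; rewrite expr2. Qed.

Lemma opnorm_spec_ge n (P : 'M[R]_n) g j : P *m P^T = 1%:M ->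
  `|g j| <= opnorm (spec P g).
Proof.
move=> PP; pose v : 'cV[R]_n := P^T *m delta_mx j 0.
have v1 : nrm v = 1.
  rewrite /nrm (dot_orthogonal (P := P^T)) ?trmxK //.
  by rewrite /dot trmx_delta mul_delta_mx mxE !eqxx sqrtr1.
apply: ub_le_sup.
  (* The set must be bounded above for [sup] to dominate its members; this crude bound suffices. The
     unit eigenvector [v] then supplies the value |g j|. *)
  exists (\sum_i `|g i|) => _ [x /= x1 <-]; rewrite !vnormE in x1 *.
  rewrite -[leRHS]mulr1.
  have s0 : 0 <= \sum_i `|g i| by rewrite sumr_ge0.
  apply: le_trans (ler_wpM2l s0 x1); apply: nrm_spec => // i.
  by rewrite (bigD1 i) //= lerDl sumr_ge0.
exists v => /=; rewrite !vnormE ?v1 // spec_eigenvector // -/v.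
by rewrite /nrm dotZl dotZr -nrm_sqr v1 expr1n mulr1 -expr2 sqrtr_sqr.
Qed.

(** This is how Assumption L reaches the range of a spectral projection: expanding x in the
    eigenbasis, only eigenvectors with |g j| >= t survive. *)
Lemma spec_big_eigspan n (P : 'M[R]_n) g (t : R) x : P *m P^T = 1%:M ->
  spec P (fun j => (t <= `|g j|)%R%:R) *m x = x -> big_eigspan (spec P g) t x.
Proof.
move=> PP xE.
exists [seq (P *m x) j 0 *: (P^T *m delta_mx j 0) | j <- enum 'I_n & (t <= `|g j|)%R].
split.
  move=> v /mapP[j]; rewrite mem_filter => /andP[tj _] ->.
  by exists (g j); split=> //; rewrite -scalemxAr spec_eigenvector // !scalerA mulrC.
rewrite big_map big_filter big_enum_cond /= big_mkcond /= -[LHS]xE.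
rewrite /spec -!mulmxA.
rewrite [X in _ *m X = _]matrix_sum_delta mulmx_sumr; apply: eq_bigr => j _.
rewrite big_ord1 mul_diag_mx !mxE -scalemxAr.
by case: ifP => _; rewrite ?mul1r ?mul0r ?scale0r.
Qed.

(** Take the least m with x < 2^m L. It is not 0 since L <= x, and minimality gives 2^(m-1) L <= x,
    that is, 2^m <= 2 x / L. *)
Lemma dyadic_scale (L x : R) : 0 < L -> L <= x ->
  exists m : nat, x < 2 ^+ m * L /\ m%:R * ln 2 <= ln (2 * x / L).
Proof.
move=> L0 Lx; have x0 : 0 < x := lt_le_trans L0 Lx.
have ex : exists m, x < 2 ^+ m * L.
  exists (Num.bound (x / L)); rewrite -ltr_pdivrMr //.
  apply: lt_le_trans (archi_boundP _) _; first by rewrite divr_ge0 // ltW.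
  by rewrite -natrX ler_nat ltnW // ltn_expl.
case: (ex_minnP ex) => -[|m] xm min; first by move: xm; rewrite mul1r ltNge Lx.
exists m.+1; split=> //.
have mx : 2 ^+ m * L <= x by rewrite leNgt; apply/negP => /min; rewrite ltnn.
rewrite mulr_natl -lnXn // ler_ln ?posrE ?exprn_gt0 ?divr_gt0 ?mulr_gt0 //.
by rewrite ler_pdivlMr // exprS -mulrA ler_pM2l.
Qed.

(** * Summing over dyadic levels and comparing eigenvalues *)

(** On level r, A has norm at most th_r = 2 th_(r+1) and the distortion is at most L / th_(r+1), so
    the bound 10 th_r al_r of the sandwich estimate is at most 20 L, whatever r. *)
Lemma sketch_near_isometric n k (L : R) (P : 'M[R]_n) d (S : 'M[R]_(k, n)) m :
  P *m P^T = 1%:M -> 0 < L -> (forall j, `|d j| < 2 ^+ m * L) ->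
  (forall j, d j != 0 -> L <= `|d j|) -> assumptionL S (spec P d) L ->
  exists Q : 'M[R]_(k, n), Q^T *m Q = spec P (fun j => (d j != 0)%:R) /\
    forall y, `|dot (S^T *m y) (spec P d *m (S^T *m y))
                - dot (Q^T *m y) (spec P d *m (Q^T *m y))|
      <= 20 * L * m%:R * dot y y.
Proof.
move=> PP L0 dm dL emb.
pose th r : R := 2 ^+ (m - r) * L.
have thL r : L <= th r by rewrite ler_peMl ?(ltW L0) // exprn_ege1 // ler1n.
have th0 r : 0 < th r := lt_le_trans L0 (thL r).
have thS r : (r < m)%N -> th r = 2 * th r.+1.
  by move=> rm; rewrite /th mulrA -exprS subnSK.
pose ind r j : R := (th r <= `|d j|)%R%:R.
pose G r := spec P (ind r).
pose al r : R := Num.min (L / th r.+1) (1 / 10).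
have al0 r : 0 <= al r by rewrite le_min divr_ge0 ?(ltW L0) ?(ltW (th0 _)) //=; lra.
have al1 r : al r <= 1 / 10 by rewrite ge_min lexx orbT.
have alL r : th r.+1 * al r <= L.
  have : al r <= L / th r.+1 by rewrite ge_min lexx.
  by rewrite ler_pdivlMr // mulrC.
have indM r s j : (r <= s)%N -> ind r j * ind s j = ind r j.
  move=> rs; rewrite /ind; case: (leP (th r)) => h; last by rewrite mul0r.
  rewrite (le_trans _ h) ?mul1r // ler_wpM2r ?(ltW L0) // ler_weXn2l ?ler1n //.
  by rewrite leq_sub2l.
have G0 : G 0%N = 0.
  rewrite -(spec0 P); apply: eq_spec => j; rewrite /ind /th subn0.
  by rewrite leNgt dm.
(* The last threshold is L, below which only the eigenvalue 0 is left. *)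
have Gm : G m = spec P (fun j => (d j != 0)%:R).
  apply: eq_spec => j; rewrite /ind /th subnn mul1r; congr (nat_of_bool _)%:R.
  apply/idP/idP => [|/dL//]; apply: contraTneq => ->.
  by rewrite normr0 -ltNge.
have [||r rm|r rm x Gx|Q [QQ QG Qal]] := @near_isometry_chain _ k n S G al m G0.
- by move=> r; apply: spec_sym.
- by move=> r s rs; rewrite mul_spec //; apply: eq_spec => j; apply: indM.
- by rewrite al0 al1.
- have [h1 h2] := emb _ (thL r.+1) x (spec_big_eigspan PP Gx).
  move: h1 h2; rewrite -/(al r) !vnormE !nrm_sqr => h1 h2.
  by rewrite ler_norml; apply/andP; split; lra.
exists Q; rewrite QQ Gm; split=> // y.
pose Ar r := spec P (fun j => d j * (ind r.+1 j - ind r j)).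
(* The levels telescope from G 0 = 0 to [G m], the projection onto the range of A. *)
have Asum : spec P d = \sum_(0 <= r < m) Ar r.
  transitivity (\sum_(0 <= r < m) (spec P d *m G r.+1 - spec P d *m G r)).
    rewrite telescope_sumr // G0 mulmx0 subr0 Gm mul_spec //.
    by apply: eq_spec => j; have [->|] := eqVneq (d j) 0; rewrite ?mul0r ?mulr1.
  apply: eq_bigr => r _; rewrite !mul_spec // -specB.
  by apply: eq_spec => j; rewrite mulrBr.
have GGG r : (0 <= r < m)%N -> `|dot (S^T *m y) (Ar r *m (S^T *m y))
      - dot (Q^T *m y) (Ar r *m (Q^T *m y))| <= 20 * L * dot y y.
  move=> rm; have indE j : (ind r.+1 j - ind r j) ^+ 2 = ind r.+1 j - ind r j.
    rewrite sqrrB -mulrnAr [ind r.+1 j * _]mulrC mulrnAl (indM _ _ _ (leqnSn r)).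
    by rewrite !expr2 !indM //; ring.
  have EE : G r.+1 - G r = spec P (fun j => ind r.+1 j - ind r j) by rewrite -specB.
  have := @sandwich_perturbation _ k n S Q (G r.+1 - G r) (Ar r) (al r) (th r).
  rewrite EE => h.
  apply: le_trans (h _ _ _ _ (al0 r) (al1 r) (ltW (th0 r)) _ _ _ y) _.
  - exact: spec_sym.
  - by rewrite mul_spec //; apply: eq_spec => j; rewrite -expr2 indE.
  - exact: spec_sym.
  - rewrite !mul_spec //; apply: eq_spec => j.
    by rewrite mulrCA -mulrA -expr2 indE -expr2 indE.
  - move=> x; apply: nrm_spec => //; first exact: ltW.
    (* An index with |d j| >= th_r belongs to both projections and drops out of the difference; any
       other has |d j| < th_r. *)
    move=> j; have [h1|h1] := leP (th r) `|d j|.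
      have -> : ind r.+1 j - ind r j = 0.
        apply/eqP; rewrite subr_eq0; apply/eqP; rewrite -(indM _ _ j (leqnSn r)).
        by rewrite /ind h1 mul1r.
      by rewrite mulr0 normr0 ltW.
    have -> : ind r j = 0 by rewrite /ind leNgt h1.
    rewrite subr0 normrM /ind normr_nat.
    by case: (leP (th r.+1)) => _; rewrite ?mulr1 ?mulr0 ltW.
  - move=> x; apply: (nrm_partial_isometry x QQ).
    by rewrite mul_spec //; apply: eq_spec => j; apply: indM.
  - by move=> x; rewrite -EE; apply: Qal.
  rewrite ler_wpM2r // thS //; have := alL r; lra.
rewrite Asum !mulmx_suml !dot_sumr -sumrB.
apply: le_trans (ler_norm_sum _ _ _) _.
apply: le_trans (ler_sum_nat GGG) _.
by rewrite sumr_const_nat subn0 -[leLHS]mulr_natr mulrAC.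
Qed.

Lemma sketch_lambda n k (L : R) (A : 'M[R]_n) (S : 'M[R]_(k, n)) :
  0 < L -> A^T = A -> A != 0 ->
  (forall a : R, eigenvalue A a -> a != 0 -> L <= `|a|) -> assumptionL S A L ->
  forall i : nat, (0 < i)%N -> 0 < lambda_ A i ->
    (i <= k)%N /\
    `|lambda_ (S *m A *m S^T) i - lambda_ A i|
      <= 20 / ln 2 * L * ln (2 * opnorm A / L).
Proof.
move=> L0 AT A0 eigL emb i i0 lam0.
have [P [d [PP AE]]] := spectralP AT.
(* [eigenvalue] refers to row eigenvectors, so the column eigenvector is transposed, using the
   symmetry of A. *)
have dL j : d j != 0 -> L <= `|d j|.
  apply: eigL; apply/eigenvalueP; exists (P^T *m delta_mx j 0 : 'cV_n)^T.
    by rewrite -{1}AT -trmx_mul AE spec_eigenvector // linearZ.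
  rewrite trmx_eq0; apply/eqP => h; have := congr1 (mulmx P) h.
  rewrite mulmxA PP mul1mx mulmx0 => /matrixP/(_ j 0) /eqP.
  by rewrite !mxE !eqxx oner_eq0.
have [j dj] : exists j, d j != 0.
  apply/existsP; apply: contraNT A0; rewrite negb_exists => /forallP d0.
  by rewrite AE -(spec0 P); apply/eqP/eq_spec => j; apply/eqP; have := d0 j; rewrite negbK.
have Lop : L <= opnorm A.
  by rewrite AE; apply: le_trans (dL _ dj) _; apply: opnorm_spec_ge.
have [m [opm mln]] := dyadic_scale L0 Lop.
have [||Q [QQ qf]] := @sketch_near_isometric n k L P d S m PP L0 _ dL.
- by move=> l; apply: le_lt_trans opm; rewrite AE; apply: opnorm_spec_ge.
- by rewrite -AE.
pose eps := 20 * L * m%:R.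
have epsle : eps <= 20 / ln 2 * L * ln (2 * opnorm A / L).
  have ln2 : 0 < ln 2 :> R by rewrite ln_gt0 // ltr1n.
  rewrite (_ : 20 / ln 2 * L * _ = 20 * L * (ln (2 * opnorm A / L) / ln 2)); last by ring.
  by rewrite ler_wpM2l ?mulr_ge0 ?(ltW L0) // ler_pdivlMr.
have eps0 : 0 <= eps by rewrite !mulr_ge0 ?(ltW L0).
have MT : (S *m A *m S^T)^T = S *m A *m S^T by rewrite !trmx_mul trmxK AT mulmxA.
have [U [e [UU ME]]] := spectralP MT.
have qf' y : `|dot y (spec U e *m y) - dot (Q^T *m y) (spec P d *m (Q^T *m y))|
    <= eps * dot y y.
  apply: le_trans (qf y); rewrite -ME -AE.
  by rewrite [dot (S^T *m y) _]dot_mulmxl trmxK !mulmxA.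
have Q1 x : nrm (Q *m x) <= nrm x.
  apply: (nrm_partial_isometry x QQ); rewrite mul_spec //.
  by apply: eq_spec => l; case: eqP; rewrite ?mulr0 ?mulr1.
have ein : (i <= n)%N by move: lam0; rewrite AE; apply: lambda_gt0_le.
set a := lambda_ A i in lam0 *.
have ai : (i <= #|[set j | (a <= d j)%R]|)%N.
  by rewrite -(le_lambda _ _ PP) // -AE.
have low s : s + eps < a -> (i <= #|[set j | (s <= e j)%R]|)%N.
  move=> sa; apply: leq_trans ai _.
  exact: (card_spec_lower PP UU QQ qf' lam0 sa).
have ik : (i <= k)%N.
  (* Any threshold below a - eps would do: already i eigenvalues counted among k indices force i <=
     k. *)
  apply: leq_trans (low (a - eps - 1) _) _; first by lra.
  by rewrite -[leqRHS]card_ord max_card.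
split=> //; apply: le_trans epsle; rewrite ME.
set b := lambda_ _ i; rewrite ler_norml; apply/andP; split.
  rewrite leNgt; apply/negP => ba.
  (* If b < a - eps, the midpoint of b and a - eps exceeds b, yet i eigenvalues of the sketch lie
     above it. *)
  have := low ((b + a - eps) / 2); rewrite -(le_lambda _ _ UU) // -/b.
  by move=> h; have := h ltac:(lra); lra.
rewrite leNgt; apply/negP => ba.
have bi : (i <= #|[set j | (b <= e j)%R]|)%N by rewrite -(le_lambda _ _ UU).
(* If b > a + eps, the midpoint of a and b - eps is positive and exceeds a, yet i eigenvalues of A
   lie above it. *)
have := @card_spec_upper _ k n P d U e Q eps b ((a + b - eps) / 2) PP UU Q1 qf'.
move=> /(_ ltac:(lra) ltac:(lra)) /(leq_trans bi).
by rewrite -(le_lambda _ _ PP) // -AE -/a; lra.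
Qed.

(** * Invariance under negation of A, and conclusion *)

Lemma opnormN n (A : 'M[R]_n) : opnorm (- A) = opnorm A.
Proof.
rewrite /opnorm; congr sup; apply/seteqP.
by split=> _ [v v1 <-]; exists v => //; rewrite mulNmx !vnormE nrmN.
Qed.

Lemma eigenvalueN n (A : 'M[R]_n) a : eigenvalue (- A) a -> eigenvalue A (- a).
Proof.
move=> /eigenvalueP[v vA v0]; apply/eigenvalueP; exists v => //.
by rewrite scaleNr -vA mulmxN opprK.
Qed.

Lemma assumptionLN n k (S : 'M[R]_(k, n)) (A : 'M[R]_n) L :
  assumptionL S A L -> assumptionL S (- A) L.
Proof.
move=> emb lam Llam x [vs [vsA xE]]; apply: emb => //; exists vs; split=> // v /vsA.
move=> [a [la Av]]; exists (- a); rewrite normrN; split=> //.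
by rewrite scaleNr -Av mulNmx opprK.
Qed.

Theorem mainTheorem17 :
  exists c : R, 0 < c /\
  forall (n k : nat) (L : R) (A : 'M[R]_n) (S : 'M[R]_(k, n)),
    0 < L -> A^T = A -> A != 0 ->
    (forall a : R, eigenvalue A a -> a != 0 -> L <= `|a|) ->
    assumptionL S A L ->
    (forall i : nat, (0 < i)%N -> 0 < lambda_ A i ->
       (i <= k)%N /\
       `|lambda_ (S *m A *m S^T) i - lambda_ A i|
         <= c * L * ln (2 * opnorm A / L)) /\
    (forall i : nat, (0 < i)%N -> mu_ A i < 0 ->
       (i <= k)%N /\
       `|mu_ (S *m A *m S^T) i - mu_ A i|
         <= c * L * ln (2 * opnorm A / L)).
Proof.
(* Each dyadic level costs 20 L, and there are at most ln (2 ||A|| / L) / ln 2 levels. *)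
exists (20 / ln 2); split; first by rewrite divr_gt0 // ln_gt0 // ltr1n.
move=> n k L A S L0 AT A0 eigL emb; split; first exact: sketch_lambda.
have muN p (M : 'M[R]_p) i : M^T = M -> mu_ M i = - lambda_ (- M) i.
  by move=> /spectralP[P [g [PP ->]]]; apply: mu_lambdaN.
move=> i i0; rewrite !muN // => [|]; last by rewrite !trmx_mul trmxK AT mulmxA.
rewrite oppr_lt0 => lam0.
have [||||ik h] := @sketch_lambda n k L (- A) S L0 _ _ _ _ i i0 lam0.
- by rewrite linearN /= AT.
- by rewrite oppr_eq0.
- by move=> a /eigenvalueN /eigL; rewrite oppr_eq0 normrN.
- exact: assumptionLN.
split=> //; rewrite -opprD normrN.
by move: h; rewrite opnormN mulmxN mulNmx.
Qed.
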